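(* For each integer $n\ge 0$, $v=G_n(z)$ is a solution of the differential equation $$(4z^2-z)v''+[n-(4n-6)z]v'+n(n-1)v=0,$$ where primes denote derivatives with respect to $z$.
   Context: The polynomials $G_n$ are defined for $z\in\mathbb{C}$ by $G_0(z)=G_1(z)=1$ and $G_n(z)=G_{n-1}(z)-zG_{n-2}(z)$ for $n\ge 2$; equivalently $G_n(z)=\sum_{k=0}^{\lfloor n/2\rfloor}(-1)^k\binom{n-k}{k}z^k$. *)

(* Defs.v *)
From HB Require Import structures.
From mathcomp Require Import all_boot all_order all_algebra.
From mathcomp Require Import complex.
From mathcomp Require Import all_classical all_reals all_analysis.
Set Implicit Arguments.
Unset Strict Implicit.
Unset Printing Implicit Defensive.
Import Order.TTheory GRing.Theory Num.Theory.
Import numFieldNormedType.Exports.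
Local Open Scope ring_scope.

(* R[i] packed as a numFieldType, so that it carries the topology of its norm
   and is a normed module over itself: [derivable] and [derive1]
   for functions from [Cplx R] to [Cplx R] are the complex notions. *)
Definition Cplx (R : realType) : numFieldType := R[i].

Fixpoint G (R : realType) (n : nat) (z : Cplx R) : Cplx R :=
  match n with
  | 0 => 1
  | m.+1 => match m with
            | 0 => 1
            | k.+1 => G m z - z * G k z
            end
  end.

(* Main.v *)
(* Two first-order relations between consecutive polynomials,
     z G_n' = 2 z G_{n+1}' + (n+1) (G_n - G_{n+1}),
     (1 - 4z) G_{n+1}' = (n+2) G_n - 2 (n+1) G_{n+1},
   propagate together along the recurrence. Differentiating the second one and
   eliminating G_n' by the first and then G_n by the second gives the
   second-order equation; no division by z or 1 - 4z is needed, so everything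
   holds as an identity of polynomials over any commutative ring. *)
Require Import Defs.
From HB Require Import structures.
From mathcomp Require Import all_boot all_order all_algebra.
From mathcomp Require Import complex.
From mathcomp Require Import all_classical all_reals all_analysis.
From mathcomp Require Import ring.
Set Implicit Arguments.
Unset Strict Implicit.
Unset Printing Implicit Defensive.
Import Order.TTheory GRing.Theory Num.Theory.
Import numFieldNormedType.Exports.
Local Open Scope ring_scope.

(** Formal counterpart of [G]: derivatives become algebraic, and [ring] can close the identities. *)
Fixpoint Gpoly (F : comNzRingType) (n : nat) : {poly F} :=
  match n with
  | 0 => 1
  | m.+1 => match m with
            | 0 => 1
            | k.+1 => Gpoly F m - 'X * Gpoly F k
            end
  end.

Lemma GpolySS (F : comNzRingType) n :
  Gpoly F n.+2 = Gpoly F n.+1 - 'X * Gpoly F n.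
Proof. by []. Qed.

Lemma horner_Gpoly (R : realType) n (z : Cplx R) : (Gpoly (Cplx R) n).[z] = G n z.
Proof.
suff: (Gpoly (Cplx R) n).[z] = G n z /\ (Gpoly (Cplx R) n.+1).[z] = G n.+1 z.
  by case.
elim: n => [|n [IHn IHn1]]; first by rewrite !hornerE.
by split=> //; rewrite GpolySS !hornerE IHn IHn1.
Qed.

Lemma Gpoly_deriv_rec (F : comNzRingType) n :
  'X * (Gpoly F n)^`() =
    2 * 'X * (Gpoly F n.+1)^`() + n.+1%:R * (Gpoly F n - Gpoly F n.+1) /\
  (1 - 4 * 'X) * (Gpoly F n.+1)^`() =
    n.+2%:R * Gpoly F n - 2 * n.+1%:R * Gpoly F n.+1.
Proof.
elim: n => [|n [IHl IHe]].
  by rewrite /= -polyC1 derivC; split; ring.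
have dSS : (Gpoly F n.+2)^`() =
    (Gpoly F n.+1)^`() - Gpoly F n - 'X * (Gpoly F n)^`().
  by rewrite GpolySS derivB derivM derivX; ring.
rewrite dSS IHl GpolySS.
move: (Gpoly F n.+1)^`() IHe => p'.
move: (Gpoly F n.+1) (Gpoly F n) => p q IHe.
split.
  apply/eqP; rewrite -subr_eq0; apply/eqP.
  transitivity (- 'X * ((1 - 4 * 'X) * p' - (n.+2%:R * q - 2 * n.+1%:R * p))).
    by ring.
  by rewrite IHe subrr mulr0.
apply/eqP; rewrite -subr_eq0; apply/eqP.
transitivity ((1 - 2 * 'X) *
    ((1 - 4 * 'X) * p' - (n.+2%:R * q - 2 * n.+1%:R * p))).
  by ring.
by rewrite IHe subrr mulr0.
Qed.

Lemma Gpoly_ode (F : comNzRingType) n (v := Gpoly F n) :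
  (4 * 'X ^+ 2 - 'X) * v^`()^`() + (n%:R - (4 * n%:R - 6) * 'X) * v^`()
    + n%:R * (n%:R - 1) * v = 0.
Proof.
rewrite /v {v}; case: n => [|n].
  by rewrite /= -polyC1 !derivC; ring.
have [IHl IHe] := Gpoly_deriv_rec F n.
have IHd : (1 - 4 * 'X) * (Gpoly F n.+1)^`()^`() =
    n.+2%:R * (Gpoly F n)^`() - (2 * n.+1%:R - 4) * (Gpoly F n.+1)^`().
  have := congr1 (fun p => deriv p) IHe.
  (* Numeral factors are turned into natural multiples, which [derivMn] differentiates directly. *)
  rewrite -[2 * n.+1%:R]natrM !mulr_natl derivM !derivB !derivMn.
  rewrite derivX derivC => IHd.
  (* The added and cancelled term is the other half of the product rule, coming from the derivative
     of [1 - 4 * 'X]. *)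
  rewrite -[LHS](addKr ((0 - 1 *+ 4) * (Gpoly F n.+1)^`())) IHd natrM mulrnA.
  ring.
move: IHl IHe IHd.
move: (Gpoly F n)^`() (Gpoly F n.+1)^`()^`() => q' p''.
move: (Gpoly F n.+1)^`() => p'.
move: (Gpoly F n.+1) (Gpoly F n) => p q IHl IHe IHd.
(* The leading coefficient factors as [- 'X * (1 - 4 * 'X)], which exposes the left side of
   [IHd]. *)
transitivity (- 'X * ((1 - 4 * 'X) * p'')
  + (n.+1%:R - (4 * n.+1%:R - 6) * 'X) * p' + n.+1%:R * n%:R * p); first by ring.
rewrite IHd.
(* Now [q'] occurs only multiplied by ['X], as the first relation requires. *)
transitivity (- n.+2%:R * ('X * q')
  + (n.+1%:R + (2 - 2 * n.+1%:R) * 'X) * p' + n.+1%:R * n%:R * p); first by ring.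
rewrite IHl.
transitivity (n.+1%:R * ((1 - 4 * 'X) * p' - (n.+2%:R * q - 2 * n.+1%:R * p))).
  by ring.
by rewrite IHe subrr mulr0.
Qed.

(** Bridge from formal to analytic derivatives: on [p * 'X + c%:P] the analytic product rule matches
    the formal one. *)
Lemma is_derive_horner (K : numFieldType) (p : {poly K}) (x : K) :
  is_derive x 1 (horner p) p^`().[x].
Proof.
elim/poly_ind: p => [|p c IHp].
  rewrite (_ : horner 0 = cst 0); last by apply/funext => y; rewrite horner0.
  by rewrite deriv0 horner0; exact: is_derive_cst.
rewrite (_ : horner _ = horner p * id + cst c); last first.
  by apply/funext => y; rewrite !hornerE.
apply: is_derive_eq.
rewrite derivD derivC addr0 derivM derivX !hornerE.
by rewrite [p.[x]%:A]mulr1 [_ *: _]mulrC addrC.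
Qed.

(** An equality of functions, so that it can be rewritten again under a second derivative. *)
Lemma derive1_horner (K : numFieldType) (p : {poly K}) :
  derive1 (horner p) = horner p^`().
Proof.
apply/funext => x; rewrite derive1E.
exact: (@derive_val _ _ _ _ _ _ _ (is_derive_horner p x)).
Qed.

Local Open Scope classical_set_scope.

Theorem theorem6 (R : realType) (n : nat) :
  let v : Cplx R -> Cplx R := G n in
  let v' : Cplx R -> Cplx R := v^`() in
  let v'' : Cplx R -> Cplx R := v'^`() in
  forall z : Cplx R,
    [/\ derivable v z 1,
        derivable v' z 1 &
        (4 * z ^+ 2 - z) * v'' z
          + (n%:R - (4 * n%:R - 6) * z) * v' z
          + n%:R * (n%:R - 1) * v z = 0].
Proof.
move=> v v' v'' z.
pose p : {poly Cplx R} := Gpoly (Cplx R) n.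
have vE : v = horner p by apply/funext => x; rewrite horner_Gpoly.
have v'E : v' = horner (deriv p).
  by rewrite /v' vE derive1_horner.
have v''E : v'' = horner (deriv (deriv p)).
  by rewrite /v'' v'E derive1_horner.
split; [by rewrite vE; have [] := is_derive_horner p z
       |by rewrite v'E; have [] := is_derive_horner (deriv p) z|].
have := congr1 (horner^~ z) (Gpoly_ode (Cplx R) n).
(* The numerals [n%:R] in the polynomial ring must be seen as constant polynomials before they
   evaluate. *)
by rewrite v''E v'E vE /= -/p -!(rmorph_nat polyC) !hornerE.
Qed.
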